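(* Let $\mathcal B$ be a BMC with $\mathbf c^*_q<\infty$ for all $q\in\mathcal T$, and consider the Q-learning process with learning rates $\lambda_i\in[0,1]$ satisfying $\sum_{i=0}^\infty\lambda_i=\infty$ and $\sum_{i=0}^\infty\lambda_i^2<\infty$, and a fixed selection distribution with $p_q\ge p_{\min}>0$ for all $q$. Then for every initial vector $Q_0\ge\mathbf 0$, $\lim_{i\to\infty}Q_i=\mathbf c^*$ almost surely.
   Context: A branching Markov chain (BMC) is $\mathcal B=(\mathcal T,p,c)$ with $\mathcal T$ a finite set of types, $p(q)$ for each $q\in\mathcal T$ a probability distribution with finite support over finite lists $\mathcal T^*$ of types (the offspring distribution), and $c:\mathcal T\to\mathbb R_{>0}$ a strictly positive cost. For a list $\alpha$, $|\alpha|$ is its length and $\alpha_i$ its $i$-th element. $\mathbf c^*_q\in[0,\infty]$ denotes the expected total cost until extinction starting from the single entity $q$; equivalently $\mathbf c^*$ is the least fixed point in $[0,\infty]^{\mathcal T}$ of $F(\mathbf x)_q=c(q)+\sum_\alpha p(q)(\alpha)\sum_{i=1}^{|\alpha|}\mathbf x_{\alpha_i}$. Q-learning process for a BMC: given deterministic learning rates $\lambda_i\in[0,1]$, a probability distribution $(p_q)_{q\in\mathcal T}$ and an initial vector $Q_0\in\mathbb R_{\ge0}^{\mathcal T}$, at each step $i=0,1,2,\dots$ a type $q_i$ is selected with probability $p_{q_i}$ independently of all previous randomness, then a list $\beta^i$ is drawn from $p(q_i)$ independently, and $Q_{i+1}(q_i)=(1-\lambda_i)Q_i(q_i)+\lambda_i\big(c(q_i)+\sum_{j=1}^{|\beta^i|}Q_i(\beta^i_j)\big)$,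 while $Q_{i+1}(q)=Q_i(q)$ for $q\ne q_i$. *)

(* Defs.v *)
From HB Require Import structures.
From mathcomp Require Import all_boot all_order all_algebra.
From mathcomp Require Import all_classical all_reals all_analysis.
Set Implicit Arguments. Unset Strict Implicit. Unset Printing Implicit Defensive.
Import Order.TTheory GRing.Theory Num.Theory.
Local Open Scope ring_scope.
Local Open Scope classical_set_scope.

(* A branching Markov chain over a finite type set T, reals R:
   - offspring distribution p q : seq T -> R with finite support supp q
   - cost c : T -> R, strictly positive. *)
Definition is_BMC (R : realType) (T : finType) (p : T -> seq T -> R)
    (supp : T -> seq (seq T)) (c : T -> R) : Prop :=
  [/\ forall q, uniq (supp q),
      forall q a, 0 <= p q a,
      forall q a, a \notin supp q -> p q a = 0,
      forall q, \sum_(a <- supp q) p q a = 1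
    & forall q, 0 < c q].

Definition Fop (R : realType) (T : finType) (p : T -> seq T -> R)
    (supp : T -> seq (seq T)) (c : T -> R) (x : T -> \bar R) : T -> \bar R :=
  fun q => ((c q)%:E + \sum_(a <- supp q) ((p q a)%:E * \sum_(t <- a) x t))%E.

Definition is_least_fixpoint (R : realType) (T : finType) (p : T -> seq T -> R)
    (supp : T -> seq (seq T)) (c : T -> R) (cs : T -> \bar R) : Prop :=
  [/\ (forall q, (0 <= cs q)%E),
      Fop p supp c cs = cs
    & forall y : T -> \bar R, (forall q, (0 <= y q)%E) ->
        Fop p supp c y = y -> forall q, (cs q <= y q)%E].

Fixpoint Qproc (R : realType) (T : finType) (c : T -> R) (lam : nat -> R)
    (Q0 : T -> R) (Omega : Type) (X : nat -> Omega -> T * seq T)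
    (i : nat) (w : Omega) : T -> R :=
  match i with
  | 0 => Q0
  | i'.+1 =>
    let Qi := Qproc c lam Q0 X i' w in
    let qi := (X i' w).1 in
    let bi := (X i' w).2 in
    fun q => if q == qi then
               (1 - lam i') * Qi q + lam i' * (c q + \sum_(t <- bi) Qi t)
             else Qi q
  end.

Definition discrete_iid_law (d : measure_display) (Omega : measurableType d)
    (R : realType) (P : probability Omega R) (V : eqType)
    (X : nat -> Omega -> V) (law : V -> R) : Prop :=
  [/\ (forall i v, measurable (X i @^-1` [set v])),
      (forall i v, P (X i @^-1` [set v]) = (law v)%:E)
    & (forall (n : nat) (v : nat -> V),
        P (\bigcap_(i in `I_n) X i @^-1` [set v i]) =
        (\prod_(i < n) P (X i @^-1` [set v i]))%E)].

(* Main.v *)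
(* Let M be the mean offspring matrix and v = c^*, so that M v = v - c < v.
   There is a row vector u > 0 with u M <= u, and for e = Q - v the diagonal
   quadratic form W(Q) = sum_q u_q / (v_q p_q) e_q^2 is a Lyapunov function:
     E[W(Q_(i+1)) | Q_i] <= (1 - k lam_i) W(Q_i) + C lam_i^2 (1 + W(Q_i)).
   Multiplying 1 + W by K_i = exp(sum_(j >= i) C lam_j^2) gives a supermartingale
   G_i + 1 with G_i >= W(Q_i) >= 0.  Since sum lam_i = oo, E[W(Q_m)] is small for
   some arbitrarily large m, hence so is E[G_m], and the maximal inequality for G
   started at time m bounds the probability that W ever exceeds eps after m.
   As offspring distributions have finite support, every expectation is a
   finite sum. *)

Require Import Defs.
From HB Require Import structures.
From mathcomp Require Import all_boot all_order all_algebra.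
From mathcomp Require Import all_classical all_reals all_analysis.
From mathcomp Require Import ring lra.
Import Order.TTheory GRing.Theory Num.Theory.
Import numFieldNormedType.Exports.
Local Open Scope ring_scope.
Local Open Scope classical_set_scope.

Set Implicit Arguments.
Unset Strict Implicit.

(** * A maximal inequality for trajectories driven by finitely supported noise *)

Section Trajectories.
Context {R : realType} {V : countType} {E : Type}.
Variables (S : seq V) (law : V -> R) (step : nat -> V -> E -> E).
Hypothesis law_ge0 : forall x, 0 <= law x.
Hypothesis law_out : forall x, x \notin S -> law x = 0.
Hypothesis law_sum : \sum_(x <- S) law x = 1.

Fixpoint traj (e : E) (x : nat -> V) (n : nat) : E :=
  if n is n'.+1 then step n' (x n') (traj e x n') else e.

(* The expectation of [f] after [k] steps from state [e] at time [n]. *)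
Fixpoint avg (k n : nat) (f : E -> R) (e : E) : R :=
  if k is k'.+1 then \sum_(x <- S) law x * avg k' n.+1 f (step n x e) else f e.

Lemma eq_traj e x y n :
  (forall i, (i < n)%N -> x i = y i) -> traj e x n = traj e y n.
Proof.
elim: n => //= n IH xy; rewrite xy// IH// => i ilt; apply: xy; exact: ltnW.
Qed.

Lemma avg_le k n f g e : (forall e', f e' <= g e') -> avg k n f e <= avg k n g e.
Proof.
move=> fg; elim: k n e => //= k IH n e.
by apply: ler_sum => x _; apply: ler_wpM2l.
Qed.

Lemma avg_ge0 k n f e : (forall e', 0 <= f e') -> 0 <= avg k n f e.
Proof.
move=> f0; elim: k n e => //= k IH n e.
by apply: sumr_ge0 => x _; apply: mulr_ge0.
Qed.

Lemma avg_affine k n f a b e :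
  avg k n (fun e' => a * f e' + b) e = a * avg k n f e + b.
Proof.
elim: k n e => //= k IH n e.
rewrite (eq_bigr (fun x => a * (law x * avg k n.+1 f (step n x e)) + law x * b)).
  by rewrite big_split/= -mulr_sumr -mulr_suml law_sum mul1r.
by move=> x _; rewrite IH mulrDr mulrCA.
Qed.

(** [avg] is defined by its first step; peeling off the last one instead lets a one-step drift bound
    act inside an average. *)
Lemma avgSr k n f e :
  avg k.+1 n f e =
  avg k n (fun e' => \sum_(x <- S) law x * f (step (n + k) x e')) e.
Proof.
elim: k n e => [|k IH] n e; first by rewrite /= addn0.
transitivity (\sum_(x <- S) law x * avg k.+1 n.+1 f (step n x e)); first by [].
by apply: eq_bigr => x _; rewrite IH addSnnS.
Qed.

(** * Events along the random path and their probabilities *)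

Context {d : measure_display} {Omega : measurableType d}.
Variables (P : probability Omega R) (X : nat -> Omega -> V).
Hypothesis iid : discrete_iid_law P X law.

Let path (w : Omega) : nat -> V := fun i => X i w.

(** [E] carries no sigma-algebra: the noise is countable, so every set of states gives a measurable
    event, by splitting on the last noise value. *)
Lemma measurable_traj e n (A : set E) :
  measurable [set w | A (traj e (path w) n)].
Proof.
elim: n A => [|n IH] A /=.
  have [Ae|nAe] := pselect (A e).
    by rewrite (_ : [set w | _] = setT)//; apply/seteqP; split.
  by rewrite (_ : [set w | _] = set0)//; apply/seteqP; split.
rewrite (_ : [set w | _] = \bigcup_x
    (X n @^-1` [set x] `&` [set w | (A \o step n x) (traj e (path w) n)])).
  apply: countable_bigcupT_measurable => [|x]; first exact: countableP.
  by apply: measurableI; [case: iid|exact: IH].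
apply/seteqP; split => [w /= Aw|w [x _ [/= <-]]] //.
by exists (X n w).
Qed.

Let cyl (n : nat) (x : nat -> V) : set Omega :=
  \bigcap_(i in `I_n) X i @^-1` [set x i].

Lemma measurable_cyl n x : measurable (cyl n x).
Proof.
by apply: fin_bigcap_measurable => // i _; case: iid.
Qed.

Lemma P_cyl n x : P (cyl n x) = (\prod_(i < n) law (x i))%:E.
Proof.
case: iid => _ PX ->; rewrite (eq_bigr (fun i : 'I_n => (law (x i))%:E)).
  by rewrite prodEFin.
by move=> i _; rewrite PX.
Qed.

Lemma measurable_notin n : measurable [set w | X n w \notin S].
Proof.
rewrite (_ : [set w | _] = \bigcup_y
  (if y \in S then set0 else X n @^-1` [set y])).
  apply: countable_bigcupT_measurable => [|y]; first exact: countableP.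
  by case: ifP => _ //; case: iid.
apply/seteqP; split => [w /= wS|w [y _]].
  by exists (X n w) => //=; rewrite (negbTE wS).
by case: ifPn => //= yS ->.
Qed.

Lemma P_notin n : P [set w | X n w \notin S] = 0%E.
Proof.
apply/(negligibleP _ (measurable_notin n)).
(* The event is a countable union of null sets: [unpickle] enumerates [V] by the naturals, and codes
   of no value contribute the empty set. *)
pose F k := if (unpickle k : option V) is Some y then
  (if y \in S then set0 else X n @^-1` [set y]) else set0.
apply: (@negligibleS _ _ _ P (\bigcup_k F k)); last first.
  apply: negligible_bigcup => k; rewrite /F.
  case: unpickle => [y|]; last exact: negligible_set0.
  case: ifPn => yS; first exact: negligible_set0.
  by case: iid => mX PX _; apply/(negligibleP _ (mX n y)); apply: etrans (PX n y) _; rewrite law_out.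
move=> w /= wS; exists (pickle (X n w)) => //.
by rewrite /F pickleK (negbTE wS).
Qed.

(** A union bound: the event of the head is removed from [A], and what remains is covered by the
    tail. *)
Lemma le_measure_bigcup_seq (s : seq V) (A : set Omega) (B : V -> set Omega)
    (b : V -> R) :
  measurable A -> (forall x, measurable (B x)) ->
  (forall x, x \in s -> (P (B x) <= (b x)%:E)%E) ->
  A `<=` [set w | exists2 x, x \in s & B x w] ->
  (P A <= (\sum_(x <- s) b x)%:E)%E.
Proof.
elim: s A => [|y s IH] A mA mB bB AB.
  rewrite big_nil (_ : A = set0) ?measure0//.
  by apply/seteqP; split => // w /AB[].
have mAy : measurable (A `\` B y) by exact: measurableD.
rewrite big_cons EFinD.
apply: (@le_trans _ _ (P (B y) + P (A `\` B y))%E).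
  apply: le_trans (measureU2 _ _ _) => //.
  apply: le_measure; rewrite ?inE//; first exact: measurableU.
  by move=> w Aw; have [|] := pselect (B y w); [left|right].
apply: leeD; first by apply: bB; rewrite mem_head.
apply: IH => // [x xs|w [/AB[x]]]; first by apply: bB; rewrite inE xs orbT.
by rewrite inE => /orP[/eqP->//|xs Bw _]; exists x.
Qed.

(** * Ville's maximal inequality for a nonnegative supermartingale *)

Variables (e0 : E) (bad : nat -> set E) (h : nat -> E -> R).
Hypothesis h_ge0 : forall n e, 0 <= h n e.
Hypothesis h_bad : forall n e, bad n e -> 1 <= h n e.
Hypothesis h_super : forall n e,
  \sum_(x <- S) law x * h n.+1 (step n x e) <= h n e.

Let hit (k n : nat) : set Omega :=
  [set w | exists2 i, (n <= i < n + k)%N & bad i (traj e0 (path w) i)].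

Lemma measurable_hit k n : measurable (hit k n).
Proof.
rewrite (_ : hit k n = \bigcup_(i in [set i | (n <= i < n + k)%N])
    [set w | bad i (traj e0 (path w) i)]); last first.
  by apply/seteqP; split => w [i]; exists i.
apply: bigcup_measurable => i _; exact: measurable_traj.
Qed.

(** On a cylinder the state at time [n] is known, so induction on the horizon [k] replaces
    conditional expectations. A bad state is covered by [1 <= h]; otherwise the event is split by
    the next noise value and [h_super] applies. *)
Lemma hit_cyl_le k n x :
  (P (cyl n x `&` hit k n) <=
    (\prod_(i < n) law (x i) * h n (traj e0 x n))%:E)%E.
Proof.
have prod_ge0 m y : 0 <= \prod_(i < m) law (y i) by apply: prodr_ge0.
elim: k n x => [|k IH] n x.
  rewrite (_ : _ `&` _ = set0).
    by rewrite measure0 lee_fin mulr_ge0.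
  by apply/seteqP; split => // w [_ [i]]; rewrite addn0; case: ltngtP.
have mI : measurable (cyl n x `&` hit k.+1 n).
  by apply: measurableI; [exact: measurable_cyl|exact: measurable_hit].
have [bx|nbx] := pselect (bad n (traj e0 x n)).
  apply: (@le_trans _ _ (P (cyl n x))).
    by apply: le_measure; rewrite ?inE//; exact: measurable_cyl.
  by rewrite P_cyl lee_fin ler_peMr// h_bad.
(* [ext y] prolongs the prefix [x] by the value [y] at time [n]; its later values are never read. *)
pose ext y i := if (i < n)%N then x i else y.
have traj_ext y : traj e0 (ext y) n = traj e0 x n.
  by apply: eq_traj => i ilt; rewrite /ext ilt.
have ext_n y : ext y n = y by rewrite /ext ltnn.
(* Discarding the null event [N] leaves only the finitely many next values in [S]. *)
pose N := [set w | X n w \notin S].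
have mN : measurable N by exact: measurable_notin.
apply: (@le_trans _ _ (P ((cyl n x `&` hit k.+1 n) `\` N))).
  have PN : P N = 0%E by exact: P_notin.
  have mIN : measurable ((cyl n x `&` hit k.+1 n) `\` N) by exact: measurableD.
  apply: (@le_trans _ _ (P ((cyl n x `&` hit k.+1 n) `\` N) + P N)%E); last first.
    by rewrite PN adde0.
  apply: le_trans (measureU2 _ _ _) => //.
  apply: le_measure; rewrite ?inE//; first exact: measurableU.
  by move=> w Aw; have [|] := pselect (N w); [right|left].
apply: (@le_trans _ _ (\sum_(y <- S)
    (\prod_(i < n) law (x i) * (law y * h n.+1 (step n y (traj e0 x n)))))%:E); last first.
  by rewrite lee_fin -mulr_sumr ler_wpM2l.
apply: (@le_measure_bigcup_seq _ _ (fun y => cyl n.+1 (ext y) `&` hit k n.+1)).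
- exact: measurableD.
- by move=> y; apply: measurableI; [exact: measurable_cyl|exact: measurable_hit].
- move=> y _.
  have -> : \prod_(i < n) law (x i) = \prod_(i < n) law (ext y i).
    by apply: eq_bigr => i _; rewrite /ext ltn_ord.
  have := IH n.+1 (ext y).
  by rewrite big_ord_recr/= ext_n traj_ext mulrA.
move=> w [[xw [i /andP[ni ink] bi]] /=]; rewrite /N/= => /negP/negPn XS.
exists (X n w) => //; split.
  move=> j /=; rewrite ltnS leq_eqVlt => /predU1P[->|jn]; rewrite /ext.
    by rewrite ltnn.
  by rewrite jn; exact: xw.
(* The hit occurs strictly after [n], since the state at time [n] is not bad. *)
exists i => //; rewrite addSnnS ink andbT ltn_neqAle ni andbT.
apply/negP => /eqP ni'; apply: nbx; rewrite ni'.
rewrite (@eq_traj e0 x (path w))//.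
by move=> j jn; rewrite -(xw j)//= ni'.
Qed.

(** The horizon tends to infinity by continuity of [P] from below. *)
Lemma ville :
  (P [set w | exists i, bad i (traj e0 (path w) i)] <= (h 0 e0)%:E)%E.
Proof.
rewrite (_ : [set w | _] = \bigcup_k hit k 0); last first.
  apply/seteqP; split => [w [i bi]|w [k _ [i _ bi]]].
    by exists i.+1 => //; exists i => //=.
  by exists i.
have mU : measurable (\bigcup_k hit k 0).
  by apply: bigcup_measurable => k _; exact: measurable_hit.
have cv : (P \o (hit ^~ 0%N)) x @[x --> \oo] --> P (\bigcup_k hit k 0).
  apply: nondecreasing_cvg_mu => //; first by move=> k; exact: measurable_hit.
  move=> k l kl; apply/subsetPset => w [i /andP[_ ik] bi].
  by exists i => //=; rewrite (leq_trans ik).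
rewrite -(cvg_lim _ cv)//; apply: lime_le.
  by apply/cvg_ex; eexists; exact: cv.
apply: nearW => k /=.
(* At time 0 the cylinder is the whole space, so any noise sequence serves as prefix. *)
have := hit_cyl_le k 0 (path point).
rewrite big_ord0 mul1r/= /cyl II0 bigcap_set0 setTI; exact.
Qed.

End Trajectories.

(** * Almost sure convergence from a Lyapunov drift *)

Section AlmostSureConvergence.
Context {R : realType} {V : countType} {E : Type}.
Variables (S : seq V) (law : V -> R) (step : nat -> V -> E -> E).
Hypothesis law_ge0 : forall x, 0 <= law x.
Hypothesis law_out : forall x, x \notin S -> law x = 0.
Hypothesis law_sum : \sum_(x <- S) law x = 1.
Variables (W : E -> R) (lam a : nat -> R) (kappa : R) (e0 : E).
Hypothesis W_ge0 : forall e, 0 <= W e.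
Hypothesis kappa_gt0 : 0 < kappa.
Hypothesis lam_ge0 : forall n, 0 <= lam n.
Hypothesis lam_sum : (fun n => \sum_(0 <= i < n) lam i) @ \oo --> +oo.
Hypothesis a_ge0 : forall n, 0 <= a n.
Hypothesis a_sum : cvg ((fun n => \sum_(0 <= i < n) a i) @ \oo).
Hypothesis W_drift : forall n e,
  \sum_(x <- S) law x * W (step n x e) <=
    (1 - kappa * lam n) * W e + a n * (1 + W e).

Let s n := \sum_(0 <= i < n) a i.
Let K n := expR (limn s - s n).
(* Subtracting 1 matters: Ville's inequality needs a mean that tends to 0. *)
Let G n e := (1 + W e) * K n - 1.
Let mean n := avg S law step n 0 W e0.

Let K_ge1 n : 1 <= K n.
Proof.
rewrite -expR0 ler_expR subr_ge0; apply: nondecreasing_cvgn_le => //.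
apply/nondecreasing_seqP => k; rewrite /s big_nat_recr//=.
by rewrite lerDl.
Qed.

Let K_cvg : K n @[n --> \oo] --> (1 : R).
Proof.
have sub0 : limn s - s n @[n --> \oo] --> (0 : R).
  by rewrite -[X in _ --> X](subrr (limn s)); apply: cvgB => //; exact: cvg_cst.
have := cvg_comp _ _ sub0 (@continuous_expR R 0).
by rewrite expR0.
Qed.

(** Since [1 + a n <= expR (a n)], passing from [K n] to [K n.+1] absorbs the factor [1 + a n] of
    the drift bound. *)
Let KS n : K n.+1 * (1 + a n) <= K n.
Proof.
have -> : K n = K n.+1 * expR (a n).
  by rewrite -expRD /K /s big_nat_recr//=; congr expR; ring.
by rewrite ler_wpM2l ?expR_ge0// expR_ge1Dx.
Qed.

Let G_ge0 n e : 0 <= G n e.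
Proof. by rewrite subr_ge0 mulr_ege1// lerDl. Qed.

(** [KS] absorbs [a n], and [K n.+1 >= 1] allows the negative term to be kept without that
    factor. *)
Let G_drift n e :
  \sum_(x <- S) law x * G n.+1 (step n x e) <= G n e - kappa * lam n * W e.
Proof.
have -> : \sum_(x <- S) law x * G n.+1 (step n x e) =
    (1 + \sum_(x <- S) law x * W (step n x e)) * K n.+1 - 1.
  rewrite mulrDl mulr_suml mul1r.
  rewrite (eq_bigr (fun x => law x * (K n.+1 - 1) +
      law x * W (step n x e) * K n.+1)); last by move=> x _; rewrite /G; ring.
  by rewrite big_split/= -mulr_suml law_sum; ring.
have := W_drift n e; set D := \sum_(x <- S) _ => DW.
have klW : 0 <= kappa * lam n * W e by rewrite !mulr_ge0// ltW.
have := K_ge1 n.+1; have := KS n; have := W_ge0 e.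
rewrite /G; set k := K n.+1; set w := W e in DW klW * => w0 kK k1.
have : (1 + D) * k <= ((1 + a n) * (1 + w) - kappa * lam n * w) * k.
  by apply: ler_wpM2r; [rewrite (le_trans _ k1)|lra].
have : k * (1 + a n) * (1 + w) <= K n * (1 + w) by apply: ler_wpM2r; lra.
have : kappa * lam n * w <= kappa * lam n * w * k by rewrite ler_peMr.
by rewrite !mulrBl; lra.
Qed.

Let mean_ge0 n : 0 <= mean n.
Proof. exact: avg_ge0. Qed.

Let avg_G n : avg S law step n 0 (G n) e0 = (1 + mean n) * K n - 1.
Proof.
rewrite (_ : G n = fun e => K n * W e + (K n - 1)).
  by rewrite avg_affine// -/(mean n); ring.
by apply/funext => e; rewrite /G; ring.
Qed.

Let avg_GS n :
  avg S law step n.+1 0 (G n.+1) e0 <=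
  avg S law step n 0 (G n) e0 - kappa * lam n * mean n.
Proof.
rewrite avgSr.
apply: (@le_trans _ _
    (avg S law step n 0 (fun e => (K n - kappa * lam n) * W e + (K n - 1)) e0)).
  apply: avg_le => // e; apply: (le_trans (G_drift _ _)).
  by rewrite /G; lra.
by rewrite avg_G avg_affine// -/(mean n); lra.
Qed.

(* The means are summable against the non-summable weights [lam]. *)
Let mean_small (delta : R) m :
  0 < delta -> exists2 n, (m <= n)%N & mean n < delta.
Proof.
move=> delta0; apply: contrapT => nmean.
have mean_ge n : (m <= n)%N -> delta <= mean n.
  by move=> mn; rewrite leNgt; apply/negP => ?; apply: nmean; exists n.
pose L n := \sum_(0 <= i < n) lam i.
pose y n := avg S law step n 0 (G n) e0.
(* [avg_GS] is telescoped, with every mean at least [delta]. *)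
have yL k : y (m + k)%N + kappa * delta * (L (m + k)%N - L m) <= y m.
  elim: k => [|k IH]; first by rewrite addn0; lra.
  rewrite addnS; apply: le_trans IH.
  have := avg_GS (m + k); rewrite -/(y _) -/(y _).
  have : kappa * lam (m + k)%N * delta <= kappa * lam (m + k)%N * mean (m + k)%N.
    by rewrite ler_wpM2l ?mean_ge ?leq_addr// mulr_ge0// ltW.
  by rewrite /L big_nat_recr//= -/(L _); lra.
(* Past this threshold the accumulated weights would force the nonnegative [y (m + N)] below 0. *)
have /cvgryPgt/(_ (y m / (kappa * delta) + L m)) [N _ /(_ (m + N)%N)] := lam_sum.
rewrite /= leq_addl => /(_ isT); rewrite -/(L _) -ltrBrDr.
rewrite ltr_pdivrMr ?mulr_gt0//; have := yL N.
have : 0 <= y (m + N)%N by apply: avg_ge0.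
lra.
Qed.

Context {d : measure_display} {Omega : measurableType d}.
Variables (P : probability Omega R) (X : nat -> Omega -> V).
Hypothesis iid : discrete_iid_law P X law.

Let W_ w n := W (traj step e0 (fun i => X i w) n).

Let exceed (eps : R) m : set Omega :=
  [set w | exists i, (m <= i)%N /\ eps <= W_ w i].

(** Up to time [m] the process [h] is a martingale by the definition of [avg]; from [m] on it is
    [G / eps], a supermartingale by [G_drift]. Ville's bound is its initial value, the mean of
    [G m / eps]. *)
Let exceed_le eps m : 0 < eps ->
  (P (exceed eps m) <=
    (((1 + mean m) * K m - 1) / eps)%:E)%E.
Proof.
move=> eps0.
(* [h n e] is the conditional expectation of [G (maxn m n) / eps] given state [e]
   at time [n]. *)
pose h n e := avg S law step (m - n) n (G (maxn m n)) e / eps.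
have -> : ((1 + mean m) * K m - 1) / eps = h 0 e0.
  by rewrite /h subn0 maxn0 avg_G.
apply: (@ville _ _ _ S law step law_ge0 law_out d Omega P X iid e0
  (fun n => [set e | (m <= n)%N /\ eps <= W e])).
- by move=> n e; rewrite /h divr_ge0 ?(ltW eps0)//; exact: avg_ge0.
(* [m <= n] unfolds to [m - n == 0], so [eqP mn] rewrites [m - n] to 0 and the average
   disappears. *)
- move=> n e [/= mn We]; rewrite /h (eqP mn)/= (maxn_idPr mn).
  rewrite ler_pdivlMr// mul1r /G lerBrDl.
  have := K_ge1 n; have := W_ge0 e => w0 k1.
  by apply: (@le_trans _ _ (1 + W e)); [lra|rewrite ler_peMr//; lra].
move=> n e; rewrite /h; under eq_bigr do rewrite mulrA.
rewrite -mulr_suml ler_pM2r ?invr_gt0//; case: (leqP m n) => mn.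
  have mn1 := leqW mn.
  rewrite (maxn_idPr mn1) (eqP mn1) (eqP mn)/=.
  apply: le_trans (G_drift _ _) _; rewrite lerBlDr lerDl.
  by rewrite !mulr_ge0// ltW.
by rewrite (maxn_idPl mn) -[in leRHS](subnSK mn).
Qed.

(** Convergence to 0 fails only if, for some [k], [W] reaches [1 / (k + 1)] at arbitrarily late
    times. Each of these countably many events is null. *)
Lemma lyapunov_as_cvg0 : {ae P, forall w, W_ w n @[n --> \oo] --> (0 : R)}.
Proof.
pose A k m := exceed k.+1%:R^-1 m.
have mA k m : measurable (A k m).
  rewrite (_ : A k m = \bigcup_(i in [set i | (m <= i)%N])
      [set w | [set e | k.+1%:R^-1 <= W e] (traj step e0 (fun i => X i w) i)]).
    by apply: bigcup_measurable => i _; exact: (measurable_traj step iid e0 i [set e | k.+1%:R^-1 <= W e]).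
  by apply/seteqP; split => w [i]; [case; exists i|exists i].
have PA k : P (\bigcap_m A k m) = 0%E.
  apply/eqP; rewrite eq_le measure_ge0 andbT; apply/lee_addgt0Pr => eta eta0.
  rewrite add0e.
  set eps : R := k.+1%:R^-1; have eps0 : 0 < eps by rewrite invr_gt0.
  (* Chosen so that [(1 + delta) ^ 2 - 1 <= 3 * delta <= eta * eps], the first inequality using
     [delta <= 1]. *)
  pose delta := Num.min 1 (eta * eps / 3).
  have delta0 : 0 < delta by rewrite lt_min ltr01 divr_gt0// mulr_gt0.
  have [d1 d2] : delta <= 1 /\ delta <= eta * eps / 3.
    by rewrite /delta; split; rewrite ge_min lexx ?orbT.
  have /cvgrPdist_lt/(_ _ delta0)[M _ HM] := K_cvg.
  have [m Mm xm] := mean_small M delta0.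
  apply: (@le_trans _ _ (P (A k m))).
    apply: le_measure; rewrite ?inE//; first exact: bigcap_measurableType.
    by move=> w; apply.
  apply: le_trans (exceed_le m eps0) _; rewrite lee_fin ler_pdivrMr//.
  have := HM m Mm; rewrite /= ltr_distlC => /andP[_ Km].
  have := mean_ge0 m; have := K_ge1 m => k1 x0.
  have : (1 + mean m) * K m <= (1 + delta) * (1 + delta).
    by apply: ler_pM; lra.
  have : delta * delta <= delta by rewrite ler_piMl// ltW.
  lra.
have : {ae P, forall w, forall k, ~ (\bigcap_m A k m) w}.
  apply: ae_foralln => k; exists (\bigcap_m A k m); split.
  - exact: bigcap_measurableType.
  - exact: PA.
  - by move=> w /= /contrapT.
apply: filterS => w nA; apply/cvgrPdist_lt => eps eps0.
have [k keps] : exists k, k.+1%:R^-1 < eps.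
  have /cvgrPdist_lt/(_ _ eps0)[k _ /(_ k (leqnn k))] := @cvg_harmonic R.
  by rewrite /= sub0r normrN ger0_norm ?invr_ge0//; exists k.
have /existsNP[m mA'] : ~ forall m, A k m w by move=> H; apply: (nA k).
exists m => // n mn /=; rewrite sub0r normrN (ger0_norm (W_ge0 _)) ltNge.
by apply/negP => Wn; apply: mA'; exists n; split => //; exact: le_trans (ltW keps) Wn.
Qed.

End AlmostSureConvergence.

(** * Subcritical nonnegative matrices *)

Lemma sum_count {R : pzRingType} {T : finType} (f : T -> R) (a : seq T) :
  \sum_(t <- a) f t = \sum_t (count_mem t a)%:R * f t.
Proof.
elim: a => [|x a IH].
  by rewrite big_nil big1// => t _; rewrite mul0r.
rewrite big_cons IH [RHS](eq_bigr (fun t => (x == t)%:R * f t +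
    (count_mem t a)%:R * f t)).
  rewrite big_split/=; congr (_ + _).
  rewrite (bigD1 x)//= eqxx mul1r big1 ?addr0// => t.
  by rewrite eq_sym => /negbTE->; rewrite mul0r.
by move=> t _; rewrite /= natrD mulrDl.
Qed.

Section Excessive.
Context {R : realType} {T : finType}.
Variables (M : T -> T -> R) (v c : T -> R).
Hypothesis M_ge0 : forall q t, 0 <= M q t.
Hypothesis v_ge0 : forall q, 0 <= v q.
Hypothesis c_gt0 : forall q, 0 < c q.
Hypothesis vE : forall q, v q = c q + \sum_t M q t * v t.

(* Pairing with [v], the inequality [x <= x M] gives [x v <= x M v = x (v - c)]. *)
Lemma subinvariant_eq0 (x : T -> R) :
  (forall t, 0 <= x t) -> (forall t, x t <= \sum_q x q * M q t) ->
  forall t, x t = 0.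
Proof.
move=> x0 xM.
have : \sum_q x q * c q <= 0.
  have -> : \sum_q x q * c q = \sum_t (x t - \sum_q x q * M q t) * v t.
    rewrite [RHS](eq_bigr (fun t => x t * v t - \sum_q x q * M q t * v t)).
      rewrite sumrB exchange_big/= -sumrB; apply: eq_bigr => q _.
      rewrite {1}vE mulrDr mulr_sumr.
      by under [X in _ + X - _]eq_bigr do rewrite mulrA; rewrite addrK.
    by move=> t _; rewrite mulrBl mulr_suml.
  by apply: sumr_le0 => t _; rewrite mulr_le0_ge0// subr_le0.
have xc0 q : true -> 0 <= x q * c q by rewrite mulr_ge0// ltW.
have S0 : 0 <= \sum_q x q * c q by exact: sumr_ge0.
move=> Sle t; have /eqP : \sum_q x q * c q = 0 by apply/eqP; rewrite eq_le Sle.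
rewrite psumr_eq0// => /allP/(_ t (mem_index_enum _)) /=.
by rewrite mulf_eq0 (gt_eqF (c_gt0 t)) orbF => /eqP.
Qed.

(* [u] is the row vector [1 (I - M)^-1]. *)
Lemma exists_excessive :
  exists u : T -> R, forall t, 0 < u t /\ \sum_q u q * M q t <= u t.
Proof.
(* The matrix [I - M], indexed by ordinals through the enumeration of [T]. *)
pose A : 'M[R]_#|T| :=
  \matrix_(i, j) ((i == j)%:R - M (enum_val i) (enum_val j)).
have mulA (y : 'rV[R]_#|T|) (t : T) : (y *m A) 0 (enum_rank t) =
    y 0 (enum_rank t) - \sum_q y 0 (enum_rank q) * M q t.
  rewrite mxE (eq_bigr (fun i => y 0 i * (i == enum_rank t)%:R -
      y 0 i * M (enum_val i) t)).
    rewrite sumrB; congr (_ - _).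
      rewrite (bigD1 (enum_rank t))//= eqxx mulr1 big1 ?addr0// => i.
      by move=> /negbTE->; rewrite mulr0.
    rewrite (reindex (@enum_rank T)); last exact/onW_bij/enum_rank_bij.
    by apply: eq_bigr => q _; rewrite enum_rankK.
  by move=> i _; rewrite !mxE enum_rankK mulrBr.
have Aunit : A \in unitmx.
  rewrite -row_free_unit; apply: inj_row_free => y yA.
  have yE t : y 0 (enum_rank t) = \sum_q y 0 (enum_rank q) * M q t.
    by apply/eqP; rewrite -subr_eq0 -mulA yA mxE.
  (* A row vector in the kernel satisfies [y = y M], so its absolute value is subinvariant by the
     triangle inequality. *)
  have y0 : forall t, `|y 0 (enum_rank t)| = 0.
    apply: subinvariant_eq0 => // t; rewrite {1}yE.
    apply: le_trans (ler_norm_sum _ _ _) _.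
    by apply: ler_sum => q _; rewrite normrM (ger0_norm (M_ge0 _ _)).
  apply/rowP => i; rewrite mxE -(enum_valK i).
  by apply/eqP; rewrite -normr_eq0 y0.
pose y : 'rV[R]_#|T| := const_mx 1 *m invmx A.
pose u (t : T) := y 0 (enum_rank t).
have uE t : u t = 1 + \sum_q u q * M q t.
  have : (y *m A) 0 (enum_rank t) = 1 by rewrite mulmxKV// mxE.
  by rewrite mulA -/(u t) => <-; rewrite addrNK.
have u_ge0 t : 0 <= u t.
  (* The negative part of [u] is subinvariant, hence zero. *)
  suff : Num.max 0 (- u t) = 0.
    by move=> H; rewrite -oppr_le0 -[leRHS]H le_max lexx orbT.
  move: t; apply: subinvariant_eq0 => t; first by rewrite le_max lexx.
  have x_ge0 q : 0 <= Num.max 0 (- u q) by rewrite le_max lexx.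
  rewrite ge_max sumr_ge0/=; last by move=> q _; rewrite mulr_ge0.
  rewrite uE opprD -sumrN.
  apply: (@le_trans _ _ (\sum_q - (u q * M q t))); first by rewrite gerDr lerN10.
  by apply: ler_sum => q _; rewrite -mulNr ler_wpM2r// le_max lexx orbT.
exists u => t; have uM0 : 0 <= \sum_q u q * M q t.
  by apply: sumr_ge0 => q _; rewrite mulr_ge0.
by have := uE t; split; lra.
Qed.

(* With [y = e / v] this is [2 y_q y_t <= y_q ^ 2 + y_t ^ 2] summed against
   the weights [u_q M_qt v_t]. *)
Lemma excessive_coercive (u e : T -> R) :
  (forall t, 0 < u t /\ \sum_q u q * M q t <= u t) ->
  \sum_q u q * c q * (e q / v q) ^+ 2 <=
  2 * \sum_q u q / v q * e q * (e q - \sum_t M q t * e t).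
Proof.
move=> uM; have v_gt0 q : 0 < v q.
  rewrite vE ltr_wpDr// sumr_ge0// => t _; exact: mulr_ge0.
pose y q := e q / v q.
have eE q : e q = v q * y q by rewrite mulrCA divff ?mulr1// gt_eqF.
have -> : 2 * \sum_q u q / v q * e q * (e q - \sum_t M q t * e t) =
   \sum_q 2 * u q * v q * y q ^+ 2 -
   \sum_q \sum_t u q * M q t * v t * (2 * y q * y t).
  rewrite mulr_sumr -sumrB; apply: eq_bigr => q _.
  rewrite -/(y q) (_ : u q / v q * e q = u q * y q); last by rewrite /y; ring.
  rewrite mulrBr mulr_sumr mulrBr {1}eE; congr (_ - _); first by ring.
  rewrite mulr_sumr; apply: eq_bigr => t _; rewrite eE; ring.
have le1 : \sum_q \sum_t u q * M q t * v t * (2 * y q * y t) <=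
    \sum_q \sum_t (u q * y q ^+ 2 * (M q t * v t) +
      v t * y t ^+ 2 * (u q * M q t)).
  apply: ler_sum => q _; apply: ler_sum => t _.
  have -> : u q * y q ^+ 2 * (M q t * v t) + v t * y t ^+ 2 * (u q * M q t) =
    u q * M q t * v t * (y q ^+ 2 + y t ^+ 2) by ring.
  apply: ler_wpM2l; first by rewrite !mulr_ge0// ltW//; case: (uM q).
  by have := sqr_ge0 (y q - y t); rewrite sqrrB; lra.
(* The first summand is summed over [t] with [M v = v - c], the second over [q] with [u M <= u]; the
   gap [c] is what survives. *)
have le2 : \sum_q \sum_t (u q * y q ^+ 2 * (M q t * v t) +
      v t * y t ^+ 2 * (u q * M q t)) <=
    \sum_q (2 * u q * v q * y q ^+ 2 - u q * c q * y q ^+ 2).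
  under eq_bigr do rewrite big_split/=.
  rewrite big_split/= [X in _ + X]exchange_big/= -big_split/=.
  apply: ler_sum => q _; rewrite -!mulr_sumr.
  have -> : \sum_t M q t * v t = v q - c q by rewrite [in RHS]vE addrC addKr.
  have : v q * y q ^+ 2 * (\sum_t u t * M t q) <= v q * y q ^+ 2 * u q.
    by apply: ler_wpM2l; [rewrite mulr_ge0// sqr_ge0|case: (uM q)].
  lra.
move: le2; rewrite sumrB /y; move: le1; rewrite /y; lra.
Qed.

End Excessive.

(** The reciprocal of 1 plus the sum of all [1 / f q] is such a bound, and makes sense for an empty
    [T] too. *)
Lemma exists_pos_lower_bound {R : realType} {T : finType} (f : T -> R) :
  (forall q, 0 < f q) -> exists2 k, 0 < k & forall q, k <= f q.
Proof.
move=> f0; have fV0 q : 0 <= (f q)^-1 by rewrite invr_ge0 ltW.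
exists (1 + \sum_q (f q)^-1)^-1.
  by rewrite invr_gt0 ltr_pwDl// sumr_ge0.
move=> q; rewrite -[leRHS]invrK lef_pV2 ?posrE ?invr_gt0//.
  by rewrite (bigD1 q)//= addrCA lerDl addr_ge0// sumr_ge0.
by rewrite ltr_pwDl// sumr_ge0.
Qed.

(** * The Lyapunov function of Q-learning *)

Section QuadraticGrowth.
Context {R : realType} {E : Type}.
Variable W : E -> R.
Hypothesis W_ge0 : forall e, 0 <= W e.

(** The constant is left unspecified, so that the noise term can be bounded by closure rules instead
    of explicit estimates. *)
Definition dominated (f : E -> R) : Prop :=
  exists2 C, 0 <= C & forall e, f e <= C * (1 + W e).

Lemma dominated_scale k f : 0 <= k -> dominated f -> dominated (fun e => k * f e).
Proof.
move=> k0 [C C0 fC]; exists (k * C); first exact: mulr_ge0.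
by move=> e; rewrite -mulrA ler_wpM2l.
Qed.

Lemma dominated_sum {I : Type} (s : seq I) (f : I -> E -> R) :
  (forall i, dominated (f i)) -> dominated (fun e => \sum_(i <- s) f i e).
Proof.
move=> fC; elim: s => [|i s [C C0 IH]].
  by exists 0 => // e; rewrite big_nil mul0r.
have [D D0 fD] := fC i; exists (D + C); first exact: addr_ge0.
by move=> e; rewrite big_cons mulrDl lerD.
Qed.

Lemma dominated_sqr_cst k : dominated (fun=> k ^+ 2).
Proof.
exists (k ^+ 2); first exact: sqr_ge0.
by move=> e; rewrite ler_peMr ?sqr_ge0// lerDl.
Qed.

(** [(f + g) ^ 2 <= 2 f ^ 2 + 2 g ^ 2], from [(f - g) ^ 2 >= 0]. *)
Lemma dominated_sqrD f g : dominated (fun e => f e ^+ 2) ->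
  dominated (fun e => g e ^+ 2) -> dominated (fun e => (f e + g e) ^+ 2).
Proof.
move=> [C C0 fC] [D D0 gD]; exists (2 * C + 2 * D).
  by rewrite addr_ge0// mulr_ge0.
move=> e; have := sqr_ge0 (f e - g e); have := fC e; have := gD e.
by rewrite sqrrB sqrrD; lra.
Qed.

Lemma dominated_sqr_sum {I : Type} (s : seq I) (f : I -> E -> R) :
  (forall i, dominated (fun e => f i e ^+ 2)) ->
  dominated (fun e => (\sum_(i <- s) f i e) ^+ 2).
Proof.
move=> fC; elim: s => [|i s IH].
  by under eq_fun do rewrite big_nil; exact: dominated_sqr_cst.
by under eq_fun do rewrite big_cons; exact: dominated_sqrD.
Qed.

End QuadraticGrowth.

(** * Expected one-step change of the Lyapunov function *)

Section Drift.
Context {R : realType} {T : finType}.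
Variables (p : T -> seq T -> R) (supp : T -> seq (seq T)) (c : T -> R).
Variables (v u : T -> R) (psel : T -> R) (lam : nat -> R).
Hypothesis p_ge0 : forall q a, 0 <= p q a.
Hypothesis p_sum : forall q, \sum_(a <- supp q) p q a = 1.
Hypothesis c_gt0 : forall q, 0 < c q.
Hypothesis v_gt0 : forall q, 0 < v q.
Hypothesis vE : forall q,
  v q = c q + \sum_(a <- supp q) p q a * \sum_(t <- a) v t.
Hypothesis psel_gt0 : forall q, 0 < psel q.
Hypothesis psel_sum : \sum_q psel q = 1.

Definition mean_offspring q t : R :=
  \sum_(a <- supp q) p q a * (count_mem t a)%:R.

Let M := mean_offspring.

Lemma mean_offspring_ge0 q t : 0 <= M q t.
Proof. by apply: sumr_ge0 => a _; rewrite mulr_ge0. Qed.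

(** Counting offspring by type turns the fixed-point equation into the matrix equation
    [v = c + M v]. *)
Lemma mean_offspringE q (f : T -> R) :
  \sum_(a <- supp q) p q a * \sum_(t <- a) f t = \sum_t M q t * f t.
Proof.
under eq_bigr do rewrite sum_count mulr_sumr.
rewrite exchange_big/=; apply: eq_bigr => t _.
by rewrite /M /mean_offspring mulr_suml; apply: eq_bigr => a _; rewrite mulrA.
Qed.

Let vME q : v q = c q + \sum_t M q t * v t.
Proof. by rewrite {1}vE mean_offspringE. Qed.

Hypothesis u_gt0 : forall t, 0 < u t.
Hypothesis uM : forall t, \sum_q u q * M q t <= u t.

Definition Qstep (n : nat) (x : T * seq T) (Q : T -> R) : T -> R :=
  fun q => if q == x.1 then
    (1 - lam n) * Q q + lam n * (c q + \sum_(t <- x.2) Q t) else Q q.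

(** Division by [psel q] offsets how often [q] is selected: on average its error enters with
    [u q / v q], the weight in [excessive_coercive]. *)
Definition weight q : R := u q / (v q * psel q).

Definition lyapunov (Q : T -> R) : R := \sum_q weight q * (Q q - v q) ^+ 2.

Definition outcomes : seq (T * seq T) :=
  [seq (q, a) | q <- enum T, a <- supp q].

Lemma sum_outcomes (f : T * seq T -> R) :
  \sum_(x <- outcomes) f x = \sum_q \sum_(a <- supp q) f (q, a).
Proof. by rewrite big_allpairs_dep big_enum. Qed.

(* The temporal-difference error. *)
Let td q a (Q : T -> R) := c q + \sum_(t <- a) Q t - Q q.

Lemma weight_gt0 q : 0 < weight q.
Proof. by rewrite divr_gt0// mulr_gt0. Qed.

Lemma lyapunov_ge0 Q : 0 <= lyapunov Q.
Proof.
by apply: sumr_ge0 => q _; rewrite mulr_ge0 ?sqr_ge0// ltW// weight_gt0.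
Qed.

Lemma le_lyapunov Q q : weight q * (Q q - v q) ^+ 2 <= lyapunov Q.
Proof.
rewrite /lyapunov (bigD1 q)//= lerDl sumr_ge0// => t _.
by rewrite mulr_ge0 ?sqr_ge0// ltW// weight_gt0.
Qed.

(** Only the coordinate [q] moves, and its error changes by [lam n * td q a Q]; the formula expands
    the square. *)
Lemma lyapunov_step n q a Q :
  lyapunov (Qstep n (q, a) Q) = lyapunov Q + weight q *
    (2 * lam n * (Q q - v q) * td q a Q + lam n ^+ 2 * td q a Q ^+ 2).
Proof.
rewrite /lyapunov (bigD1 q)//= [in RHS](bigD1 q)//= /Qstep eqxx/=.
rewrite [X in _ + X = _](eq_bigr (fun t => weight t * (Q t - v t) ^+ 2)).
  by rewrite /td; ring.
by move=> t /negbTE->.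
Qed.

Let qlaw (x : T * seq T) := psel x.1 * p x.1 x.2.

Lemma mean_lyapunov_step n Q :
  \sum_(x <- outcomes) qlaw x * lyapunov (Qstep n x Q) =
  lyapunov Q -
  2 * lam n * (\sum_q u q / v q * (Q q - v q) *
    (Q q - v q - \sum_t M q t * (Q t - v t))) +
  lam n ^+ 2 *
    \sum_q psel q * weight q * \sum_(a <- supp q) p q a * td q a Q ^+ 2.
Proof.
rewrite sum_outcomes.
have -> : lyapunov Q = \sum_q psel q * lyapunov Q.
  by rewrite -mulr_suml psel_sum mul1r.
rewrite !mulr_sumr -sumrB -big_split/=; apply: eq_bigr => q _.
(* Subtracting [v = c + M v] shows that the mean temporal-difference error is [- (e - M e)] at [q],
   where [e = Q - v]. *)
have td_mean : \sum_(a <- supp q) p q a * td q a Q =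
    - (Q q - v q - \sum_t M q t * (Q t - v t)).
  rewrite (eq_bigr (fun a => p q a * (c q - Q q) +
     p q a * \sum_(t <- a) Q t)); last by move=> a _; rewrite /td; ring.
  rewrite big_split/= -mulr_suml p_sum mean_offspringE.
  under [in RHS]eq_bigr do rewrite mulrBr.
  by rewrite sumrB vME; ring.
have weightE : psel q * weight q = u q / v q.
  by rewrite /weight; field; rewrite !gt_eqF.
rewrite (eq_bigr (fun a => p q a * (psel q * lyapunov Q) +
   (psel q * weight q * 2 * lam n * (Q q - v q) * (p q a * td q a Q) +
    psel q * weight q * lam n ^+ 2 * (p q a * td q a Q ^+ 2)))); last first.
  by move=> a _; rewrite /qlaw lyapunov_step/=; ring.
rewrite !big_split/= -mulr_suml p_sum -!mulr_sumr td_mean !weightE.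
ring.
Qed.

(** The temporal-difference error is affine in [Q], and each [(Q t - v t) ^ 2] is at most
    [lyapunov Q / weight t]; the closure rules do the rest. *)
Lemma noise_dominated : dominated lyapunov (fun Q =>
  \sum_q psel q * weight q * \sum_(a <- supp q) p q a * td q a Q ^+ 2).
Proof.
have dQ t : dominated lyapunov (fun Q => Q t ^+ 2).
  have -> : (fun Q : T -> R => Q t ^+ 2) =
      (fun Q : T -> R => (Q t - v t + v t) ^+ 2).
    by apply/funext => Q; rewrite subrK.
  apply: dominated_sqrD; last exact: dominated_sqr_cst lyapunov_ge0 _.
  exists (weight t)^-1; first by rewrite invr_ge0 ltW// weight_gt0.
  move=> Q; rewrite mulrC ler_pdivlMr ?weight_gt0// mulrC.
  by apply: le_trans (le_lyapunov Q t) _; rewrite lerDr.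
apply: dominated_sum => q.
apply: dominated_scale; first by rewrite mulr_ge0// ltW// weight_gt0.
apply: dominated_sum => a; apply: dominated_scale => //.
rewrite /td; apply: dominated_sqrD.
  apply: dominated_sqrD; first exact: dominated_sqr_cst lyapunov_ge0 _.
  exact: dominated_sqr_sum lyapunov_ge0 _ _ _ dQ.
have -> : (fun Q : T -> R => (- Q q) ^+ 2) = (fun Q => Q q ^+ 2).
  by apply/funext => Q; rewrite sqrrN.
exact: dQ.
Qed.

Hypothesis lam_ge0 : forall n, 0 <= lam n.

Lemma lyapunov_drift : exists2 kappa, 0 < kappa & exists2 C, 0 <= C &
  forall n Q, \sum_(x <- outcomes) qlaw x * lyapunov (Qstep n x Q) <=
    (1 - kappa * lam n) * lyapunov Q + C * lam n ^+ 2 * (1 + lyapunov Q).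
Proof.
(* [k] bounds from below the ratio of the coefficient [u c / v ^ 2] in [excessive_coercive] to
   [weight], so the coercive sum dominates [k * lyapunov Q]. *)
have [k k0 kle] := @exists_pos_lower_bound R T (fun q => c q * psel q / v q)
  (fun q => divr_gt0 (mulr_gt0 (c_gt0 q) (psel_gt0 q)) (v_gt0 q)).
have [C C0 CW] := noise_dominated.
exists k => //; exists C => // n Q; rewrite mean_lyapunov_step.
have := ler_wpM2l (sqr_ge0 (lam n)) (CW Q).
have := @excessive_coercive R T M v c mean_offspring_ge0 (fun q => ltW (v_gt0 q)) c_gt0 vME u
  (fun q => Q q - v q) (fun t => conj (u_gt0 t) (uM t)).
have : k * lyapunov Q <= \sum_q u q * c q * ((Q q - v q) / v q) ^+ 2.
  rewrite mulr_sumr; apply: ler_sum => q _.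
  have -> : u q * c q * ((Q q - v q) / v q) ^+ 2 =
      (c q * psel q / v q) * (weight q * (Q q - v q) ^+ 2).
    by rewrite /weight; field; rewrite !gt_eqF.
  by rewrite ler_wpM2r// mulr_ge0 ?sqr_ge0// ltW// weight_gt0.
set X := \sum_q _; set Y := \sum_q _; set Z := \sum_q _ => kX XY ZC.
have : lam n * (k * lyapunov Q) <= lam n * (2 * Y).
  by rewrite ler_wpM2l// (le_trans kX).
lra.
Qed.

End Drift.

(** * Transfer of the Lyapunov criterion to the Q-learning process *)

Lemma QprocE {R : realType} {T : finType} (c : T -> R) (lam : nat -> R)
    (Q0 : T -> R) (Omega : Type) (X : nat -> Omega -> T * seq T) n w :
  Qproc c lam Q0 X n w = traj (Qstep c lam) Q0 (fun i => X i w) n.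
Proof. by elim: n => //= n ->. Qed.

Lemma finite_fixpointE {R : realType} {T : finType} (p : T -> seq T -> R)
    (supp : T -> seq (seq T)) (c : T -> R) (v : T -> R) :
  Fop p supp c (fun q => (v q)%:E) = (fun q => (v q)%:E) ->
  forall q, v q = c q + \sum_(a <- supp q) p q a * \sum_(t <- a) v t.
Proof.
move=> Fv q; apply: EFin_inj; rewrite -[LHS]/((fun q => (v q)%:E) q) -Fv.
rewrite /Fop EFinD -sumEFin; congr (_ + _)%E.
by apply: eq_bigr => a _; rewrite EFinM -sumEFin.
Qed.

Lemma cvg_sqr0 {R : realType} (x : R ^nat) (l : R) :
  (x n - l) ^+ 2 @[n --> \oo] --> (0 : R) -> x n @[n --> \oo] --> l.
Proof.
move=> x2; apply/cvgrPdist_lt => eps eps0.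
have /cvgrPdist_lt/(_ (eps ^+ 2)) := x2; rewrite exprn_gt0// => /(_ isT).
apply: filterS => n /=.
rewrite sub0r normrN ger0_norm ?sqr_ge0// -normrN opprB => H.
by rewrite -(ltr_pXn2r (ltn0Sn 1))// ?nnegrE ?ltW// real_normK// num_real.
Qed.

Theorem theorem5 (R : realType) (T : finType)
    (p : T -> seq T -> R) (supp : T -> seq (seq T)) (c : T -> R)
    (cs : T -> \bar R)
    (lam : nat -> R) (psel : T -> R) (pmin : R)
    (d : measure_display) (Omega : measurableType d) (P : probability Omega R)
    (X : nat -> Omega -> T * seq T) (Q0 : T -> R) :
  is_BMC p supp c ->
  is_least_fixpoint p supp c cs ->
  (forall q, (cs q < +oo)%E) ->
  (forall i, 0 <= lam i <= 1) ->
  (fun n => \sum_(0 <= i < n) lam i) @ \oo --> +oo ->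
  cvg ((fun n => \sum_(0 <= i < n) lam i ^+ 2) @ \oo) ->
  (forall q, 0 <= psel q) -> \sum_q psel q = 1 ->
  0 < pmin -> (forall q, pmin <= psel q) ->
  discrete_iid_law P X (fun v => psel v.1 * p v.1 v.2) ->
  (forall q, 0 <= Q0 q) ->
  {ae P, forall w, forall q,
     (fun i => Qproc c lam Q0 X i w q) @ \oo --> fine (cs q)}.
Proof.
move=> [_ p_ge0 p_out p_sum c_gt0] [cs_ge0 csE _] cs_fin lam01 lam_sum lam2_sum.
move=> psel_ge0 psel_sum pmin_gt0 pmin_le iid Q0_ge0.
(* Finiteness of [cs] lets the fixed-point equation be read over the reals. *)
pose v q := fine (cs q).
have v_cs q : (v q)%:E = cs q by rewrite fineK// ge0_fin_numE.
have v_ge0 q : 0 <= v q by rewrite fine_ge0.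
have vE : forall q, v q = c q + \sum_(a <- supp q) p q a * \sum_(t <- a) v t.
  apply: finite_fixpointE; have -> : (fun q => (v q)%:E) = cs by exact/funext.
  exact: csE.
have v_gt0 q : 0 < v q.
  rewrite vE ltr_wpDr// sumr_ge0// => a _.
  by rewrite mulr_ge0// sumr_ge0.
have psel_gt0 q : 0 < psel q by exact: lt_le_trans (pmin_le q).
have [u uM] := exists_excessive (mean_offspring_ge0 supp p_ge0) v_ge0 c_gt0
  (fun q => etrans (vE q) (congr1 (+%R (c q)) (mean_offspringE p supp q v))).
have u_gt0 t : 0 < u t by case: (uM t).
have lam_ge0 n : 0 <= lam n by case/andP: (lam01 n).
have [kappa kappa0 [C C0 drift]] := lyapunov_drift p_ge0 p_sum c_gt0 v_gt0 vE
  psel_gt0 psel_sum u_gt0 (fun t => proj2 (uM t)) lam_ge0.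
have law_ge0 (x : T * seq T) : 0 <= psel x.1 * p x.1 x.2 by exact: mulr_ge0.
have law_out x : x \notin outcomes supp -> psel x.1 * p x.1 x.2 = 0.
  case: x => q a; rewrite /outcomes => qa; rewrite /= p_out ?mulr0//.
  apply: contra qa => qa; apply/allpairsPdep; exists q, a.
  by rewrite mem_enum.
have law_sum : \sum_(x <- outcomes supp) psel x.1 * p x.1 x.2 = 1.
  rewrite sum_outcomes -psel_sum; apply: eq_bigr => q _.
  by rewrite /= -mulr_sumr p_sum mulr1.
(* [C * lam n ^+ 2] takes the place of [a n] in the Lyapunov criterion. *)
have Clam2_ge0 n : 0 <= C * lam n ^+ 2 by rewrite mulr_ge0 ?sqr_ge0.
have Clam2_sum : cvgn (fun n => \sum_(0 <= i < n) C * lam i ^+ 2).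
  rewrite (_ : (fun n => _) = (fun n => C * \sum_(0 <= i < n) lam i ^+ 2)).
    exact: is_cvgMr.
  by apply/funext => n; rewrite mulr_sumr.
have := @lyapunov_as_cvg0 R _ _ _ _ _ law_ge0 law_out law_sum _ _ _ _ Q0
  (lyapunov_ge0 v_gt0 psel_gt0 u_gt0) kappa0 lam_ge0 lam_sum Clam2_ge0 Clam2_sum
  drift d Omega P X iid.
apply: filterS => w Wcvg q; apply: cvg_sqr0.
have w_gt0 := weight_gt0 v_gt0 psel_gt0 u_gt0 q.
(* Each squared coordinate error lies between 0 and the Lyapunov function divided by the weight of
   that coordinate. *)
apply: (@squeeze_cvgr _ _ _ _ (cst 0) (fun n =>
  (weight v u psel q)^-1 * lyapunov v u psel (Qproc c lam Q0 X n w))).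
- apply: nearW => n; rewrite sqr_ge0/= -ler_pdivrMl ?invr_gt0// invrK.
  exact: le_lyapunov.
- exact: cvg_cst.
rewrite -[X in _ --> X](mulr0 (weight v u psel q)^-1).
by under eq_fun do rewrite QprocE; apply: cvgMr.
Qed.
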